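(* Let $A = L^1(\mathbb{R})$. Let $f \in A$ be such that $f \geq 0$ and $0 \notin \mathrm{supp} f$. Then $V_A(f) = \|f\|_1 \mathbb{D}$. In particular, $V_A(f)$ is convex.
   Context: $\mathbb{D} = \{z \in \mathbb{C} : |z| \leq 1\}$ is the closed unit disc. $L^1(\mathbb{R})$ is the Banach algebra of (classes of) complex-valued Lebesgue integrable functions on $\mathbb{R}$ with the norm $\|f\|_1 = \int_{\mathbb{R}}|f(t)|\,dt$ and the convolution product $(f \star g)(s) = \int_{\mathbb{R}} f(s-t)g(t)\,dt$. $\mathrm{supp} f$ is the (closed, essential) support of $f$, and $f \ge 0$ is understood almost everywhere. For a complex normed algebra $(A,\|\cdot\|)$ with dual $A^*$, let $S(A) = \{x \in A : \|x\| = 1\}$, and for $x \in S(A)$ let $D_A(x) = \{\varphi \in A^* : \|\varphi\| = 1 = \varphi(x)\}$. For $a \in A$ and $x \in S(A)$ let $V_A(a;x) = \{\varphi(ax) : \varphi \in D_A(x)\}$ (where $ax$ is the product in $A$). The spatial numerical range of $a$ is $V_A(a) = \bigcup\{V_A(a;x) : x \in S(A)\} \subseteq \mathbb{C}$. *)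

(* Defs.v *)
From HB Require Import structures.
From mathcomp Require Import all_boot all_order all_algebra.
From mathcomp Require Import ring_quotient complex ring lra.
From mathcomp Require Import all_classical all_reals all_analysis measurable_realfun.
Set Implicit Arguments.
Unset Strict Implicit.
Unset Printing Implicit Defensive.
Import Order.TTheory GRing.Theory Num.Theory.
Import numFieldNormedType.Exports.
Local Open Scope classical_set_scope.
Local Open Scope ring_scope.
Local Open Scope complex_scope.

HB.mixin Record NormedModule_isNormedAlgebra (K : numDomainType) A
    & NormedModule K A := {
  amul : A -> A -> A;
  amulA : associative amul;
  amulDl : left_distributive amul +%R;
  amulDr : right_distributive amul +%R;
  amulZl : forall (k : K) (x y : A), amul (k *: x) y = k *: amul x y;
  amulZr : forall (k : K) (x y : A), amul x (k *: y) = k *: amul x y;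
  ler_norm_amul : forall x y : A, `|amul x y| <= `|x| * `|y|
}.

(* Not assumed unital: MathComp's algebras all have a unit, but L^1(R) has none. *)
#[short(type="normedAlgType")]
HB.structure Definition NormedAlgebra (K : numDomainType) :=
  {A of NormedModule K A & NormedModule_isNormedAlgebra K A}.

(* The R-valued complex modulus; `|z| is the same number seen in R[i]. *)
Notation modulus := ComplexField.Normc.normc.

Section numerical_range.
Context {R : realType} {A : normedAlgType R[i]}.

Definition unit_sphere : set A := [set x | `|x| = 1].

Definition dual_norm (phi : A -> R[i]) : R :=
  sup [set modulus (phi x) | x in [set x : A | `|x| <= 1]].

Definition support_functionals (x : A) : set {linear A -> R[i]^o} :=
  [set phi | [/\ continuous (phi : A -> R[i]^o), dual_norm phi = 1 & phi x = 1]].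

Definition spatial_range_at (a x : A) : set R[i] :=
  [set phi (amul a x) | phi in support_functionals x].

Definition spatial_range (a : A) : set R[i] :=
  \bigcup_(x in unit_sphere) spatial_range_at a x.

End numerical_range.

Definition closed_unit_disc (R : realType) : set R[i] := [set z | `|z| <= 1].
Arguments closed_unit_disc : clear implicits.

Local Notation Re := (@complex.Re _).
Local Notation Im := (@complex.Im _).


Section complex_arith.
Context {R : rcfType}.
Implicit Types z w : R[i].

Lemma ReD z w : Re (z + w) = Re z + Re w. Proof. by case: z; case: w. Qed.
Lemma ImD z w : Im (z + w) = Im z + Im w. Proof. by case: z; case: w. Qed.
Lemma ReN z : Re (- z) = - Re z. Proof. by case: z. Qed.
Lemma ImN z : Im (- z) = - Im z. Proof. by case: z. Qed.
Lemma ReM z w : Re (z * w) = Re z * Re w - Im z * Im w.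
Proof. by case: z; case: w. Qed.
Lemma ImM z w : Im (z * w) = Re z * Im w + Im z * Re w.
Proof. by case: z; case: w. Qed.
Lemma complexP z w : Re z = Re w -> Im z = Im w -> z = w.
Proof. by case: z w => a b [c d] /= -> ->. Qed.

Lemma modulusE z : modulus z = Num.sqrt (Re z ^+ 2 + Im z ^+ 2).
Proof. by case: z. Qed.
Lemma norm_modulus z : `|z| = (modulus z)%:C. Proof. by case: z. Qed.
Lemma modulus_ge0 z : 0 <= modulus z.
Proof. by rewrite modulusE sqrtr_ge0. Qed.
Lemma modulusM z w : modulus (z * w) = modulus z * modulus w.
Proof. exact: ComplexField.Normc.normcM. Qed.
Lemma modulusD z w : modulus (z + w) <= modulus z + modulus w.
Proof. exact: le_normcD. Qed.
Lemma modulus_eq0 z : modulus z = 0 -> z = 0.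
Proof. exact: ComplexField.Normc.eq0_normc. Qed.
Lemma modulus0 : modulus (0 : R[i]) = 0.
Proof. exact: ComplexField.Normc.normc0. Qed.
Lemma ler_Re z : `|Re z| <= modulus z.
Proof. by rewrite modulusE -sqrtr_sqr ler_wsqrtr// lerDl sqr_ge0. Qed.
Lemma ler_Im z : `|Im z| <= modulus z.
Proof. by rewrite modulusE -sqrtr_sqr ler_wsqrtr// lerDr sqr_ge0. Qed.
Lemma ler_modulus z : modulus z <= `|Re z| + `|Im z|.
Proof.
have h : 0 <= `|Re z| + `|Im z| by rewrite addr_ge0.
rewrite modulusE -(ger0_norm h) -[leRHS]sqrtr_sqr ler_wsqrtr//.
by rewrite sqrrD !real_normK ?num_real// addrAC lerDl mulrn_wge0// mulr_ge0.
Qed.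

End complex_arith.

Section complex_integral.
Context d (T : measurableType d) (R : realType).
Variable mu : {measure set T -> \bar R}.
Implicit Types f g : T -> R[i].

Let integrable_scale (k : R) (h : T -> R) :
  mu.-integrable setT (fun x => (h x)%:E) ->
  mu.-integrable setT (fun x => (k * h x)%:E).
Proof. by move=> hi; under eq_fun do rewrite EFinM; exact: integrableZl. Qed.

Definition cmeasurable f :=
  measurable_fun setT (fun x => Re (f x)) /\
  measurable_fun setT (fun x => Im (f x)).

Definition cintegrable f :=
  mu.-integrable setT (fun x => (Re (f x))%:E) /\
  mu.-integrable setT (fun x => (Im (f x))%:E).

Definition cintegral f : R[i] :=
  (\int[mu]_x Re (f x)) +i* (\int[mu]_x Im (f x)).

Lemma cmeasurableD f g :
  cmeasurable f -> cmeasurable g -> cmeasurable (fun x => f x + g x).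
Proof.
move=> [fr fi] [gr gi]; split.
- by under eq_fun do rewrite ReD; exact: measurable_funD.
- by under eq_fun do rewrite ImD; exact: measurable_funD.
Qed.

Lemma cmeasurableM f g :
  cmeasurable f -> cmeasurable g -> cmeasurable (fun x => f x * g x).
Proof.
move=> [fr fi] [gr gi]; split.
- by under eq_fun do rewrite ReM; apply: measurable_funB; exact: measurable_funM.
- by under eq_fun do rewrite ImM; apply: measurable_funD; exact: measurable_funM.
Qed.

Lemma cmeasurable_modulus f :
  cmeasurable f -> measurable_fun setT (fun x => modulus (f x)).
Proof.
move=> [fr fi]; under eq_fun do rewrite modulusE.
apply: (@measurableT_comp _ _ _ _ _ _ (@Num.sqrt R)).
  by apply: continuous_measurable_fun; exact: sqrt_continuous.
by apply: measurable_funD; exact: measurable_funX.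
Qed.

Lemma cintegrable_measurable f : cintegrable f -> cmeasurable f.
Proof.
by move=> [/measurable_int/measurable_EFinP ? /measurable_int/measurable_EFinP].
Qed.

Lemma cintegrableP f : cintegrable f <->
  cmeasurable f /\ mu.-integrable setT (fun x => (modulus (f x))%:E).
Proof.
split=> [fi|[mf fi]].
  split; first exact: cintegrable_measurable.
  case: (fi) => fr fim.
  apply: (@le_integrable _ _ _ _ _ _ _
    (fun x => (`|Re (f x)| + `|Im (f x)|)%:E)) => //.
  - exact/measurable_EFinP/cmeasurable_modulus/cintegrable_measurable.
  - move=> x _; rewrite !abse_EFin lee_fin ger0_norm ?modulus_ge0//.
    by rewrite [leRHS]ger0_norm ?addr_ge0// ler_modulus.
  - under eq_fun do rewrite EFinD -!abse_EFin.
    by apply: integrableD => //; exact: integrable_abse.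
split; apply: le_integrable fi => //; try by case: mf => *; exact/measurable_EFinP.
- by move=> x _; rewrite !abse_EFin lee_fin [leRHS]ger0_norm ?modulus_ge0// ler_Re.
- by move=> x _; rewrite !abse_EFin lee_fin [leRHS]ger0_norm ?modulus_ge0// ler_Im.
Qed.

Lemma cintegrable0 : cintegrable (fun=> 0).
Proof. by split; exact: integrable0. Qed.

Lemma cintegrableD f g :
  cintegrable f -> cintegrable g -> cintegrable (fun x => f x + g x).
Proof.
move=> [fr fi] [gr gi]; split.
- by under eq_fun do rewrite ReD EFinD; exact: integrableD.
- by under eq_fun do rewrite ImD EFinD; exact: integrableD.
Qed.

Lemma cintegrableZ c f : cintegrable f -> cintegrable (fun x => c * f x).
Proof.
move=> [fr fi]; split.
- under eq_fun do rewrite ReM EFinB !EFinM.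
  by apply: integrableB => //; exact: integrableZl.
- under eq_fun do rewrite ImM EFinD !EFinM.
  by apply: integrableD => //; exact: integrableZl.
Qed.

Lemma cintegralD f g : cintegrable f -> cintegrable g ->
  cintegral (fun x => f x + g x) = cintegral f + cintegral g.
Proof.
move=> [fr fi] [gr gi]; apply: complexP; rewrite (ReD, ImD) /=.
- by under eq_Rintegral do rewrite ReD; rewrite RintegralD.
- by under eq_Rintegral do rewrite ImD; rewrite RintegralD.
Qed.

Lemma cintegralZ c f : cintegrable f ->
  cintegral (fun x => c * f x) = c * cintegral f.
Proof.
move=> [fr fi]; apply: complexP; rewrite (ReM, ImM) /=.
- under eq_Rintegral do rewrite ReM.
  rewrite RintegralB//; [|exact: integrable_scale..].
  by rewrite !RintegralZl.
- under eq_Rintegral do rewrite ImM.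
  rewrite RintegralD//; [|exact: integrable_scale..].
  by rewrite !RintegralZl.
Qed.

Lemma eq_cintegral f g : f =1 g -> cintegral f = cintegral g.
Proof. by move=> /funext ->. Qed.

Lemma ae_eq_cintegral f g : cmeasurable f -> cmeasurable g ->
  {ae mu, forall x, f x = g x} -> cintegral f = cintegral g.
Proof.
move=> [fr fi] [gr gi] fg; rewrite /cintegral /Rintegral.
congr (fine _ +i* fine _); apply: ae_eq_integral => //;
  try exact/measurable_EFinP; by apply: filterS fg => x -> _.
Qed.

Lemma ae_eq_cintegrable f g : cmeasurable g ->
  {ae mu, forall x, f x = g x} -> cintegrable f -> cintegrable g.
Proof.
move=> mg fg /cintegrableP[mf /integrableP[_ fi]].
apply/cintegrableP; split => //; apply/integrableP; split.
  exact/measurable_EFinP/cmeasurable_modulus.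
rewrite -(@ae_eq_integral _ _ _ mu setT _ (fun x => `|(modulus (f x))%:E|)%E)//.
- by apply: measurableT_comp => //; exact/measurable_EFinP/cmeasurable_modulus.
- by apply: measurableT_comp => //; exact/measurable_EFinP/cmeasurable_modulus.
- by apply: filterS fg => x -> _.
Qed.

Lemma modulus_integrable f : cintegrable f ->
  mu.-integrable setT (fun x => (modulus (f x))%:E).
Proof. by move=> /cintegrableP[]. Qed.

Lemma le_modulus_cintegral f : cintegrable f ->
  modulus (cintegral f) <= \int[mu]_x modulus (f x).
Proof.
move=> fi; set I := cintegral f.
have [I0|I0] := eqVneq (modulus I) 0.
  by rewrite I0; apply: Rintegral_ge0 => x _; exact: modulus_ge0.
have IJ : modulus I ^+ 2 <= modulus I * \int[mu]_x modulus (f x).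
  have -> : modulus I ^+ 2 = \int[mu]_x Re (I^* * f x).
    have := cintegralZ I^* fi; rewrite -/I => /(congr1 (@complex.Re R)) /= ->.
    by rewrite sqr_sqrtr ?addr_ge0 ?sqr_ge0// mulNr opprK !expr2.
  rewrite -RintegralZl ?modulus_integrable//.
  have [ci _] := cintegrableZ I^* fi.
  apply: le_Rintegral => //.
    exact/integrable_scale/modulus_integrable.
  move=> x _; rewrite (le_trans (ler_norm _))// (le_trans (ler_Re _))//.
  rewrite modulusM ler_wpM2r ?modulus_ge0// le_eqVlt; apply/orP; left.
  by apply/eqP; rewrite !modulusE; case: (I) => a b /=; rewrite sqrrN.
by rewrite -(ler_pM2l (_ : 0 < modulus I)) -?expr2// lt_neqAle eq_sym I0 modulus_ge0.
Qed.

End complex_integral.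

Local Open Scope quotient_scope.
Section L1_def.
Context (R : realType).
Local Notation mu := (@lebesgue_measure R).
Let aeF := ae_filter_ringOfSetsType mu.

Definition integrable_pred : {pred R -> R[i]} := mem [set f | cintegrable mu f].

Record intfun := IntFun {
  intfun_val :> R -> R[i];
  _ : intfun_val \in integrable_pred }.

HB.instance Definition _ := [isSub for intfun_val].
HB.instance Definition _ := [Choice of intfun by <:].

Fact integrable_pred_submod : submod_closed integrable_pred.
Proof.
split; first by rewrite inE; exact: cintegrable0.
move=> k f g; rewrite !inE => fi gi.
by apply: cintegrableD => //; exact: cintegrableZ.
Qed.
HB.instance Definition _ :=
  GRing.isSubmodClosed.Build R[i] (R -> R[i]) integrable_pred
    integrable_pred_submod.
HB.instance Definition _ := [SubChoice_isSubLmodule of intfun by <:].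

Lemma intfunP (f : intfun) : cintegrable mu f.
Proof. by case: f => f /=; rewrite inE. Qed.

Definition null_pred : {pred intfun} :=
  mem [set f : intfun | {ae mu, forall t, f t = 0}].

Fact null_pred_zmod : zmod_closed null_pred.
Proof.
split; first by rewrite inE; exact: aeW.
move=> f g; rewrite !inE => f0 g0.
change {ae mu, forall t, (f - g) t = 0}.
by apply: (@filterS2 _ _ aeF _ _ _ _ f0 g0) => t ft gt; rewrite [LHS](_ : _ = f t - g t)// ft gt subr0.
Qed.
HB.instance Definition _ :=
  GRing.isZmodClosed.Build intfun null_pred null_pred_zmod.

Definition L1 : Type := Quotient.quot null_pred.
HB.instance Definition _ := GRing.Zmodule.on L1.
HB.instance Definition _ := EqQuotient.on L1.
HB.instance Definition _ := ZmodQuotient.on L1.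

Definition L1_repr (f : L1) : R -> R[i] := (repr f : intfun).
Coercion L1_repr : L1 >-> Funclass.



Definition L1_class (f : R -> R[i]) (fi : cintegrable mu f) : L1 :=
  \pi_L1 (IntFun (mem_set fi : f \in integrable_pred)).

Lemma L1_integrable (f : L1) : cintegrable mu f.
Proof. exact: intfunP. Qed.

Lemma L1_measurable (f : L1) : cmeasurable f.
Proof. exact: cintegrable_measurable (L1_integrable f). Qed.

Lemma pi_L1_eq (f g : intfun) :
  \pi_L1 f = \pi_L1 g <-> {ae mu, forall t, f t = g t}.
Proof.
have -> : (\pi_L1 f = \pi_L1 g) <-> f - g \in null_pred.
  by rewrite Quotient.idealrBE; split=> [->|/eqP].
rewrite inE; split=> fg.
- apply: (@filterS _ _ aeF _ _ _ fg) => t /eqP.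
  by rewrite [X in X == _](_ : _ = f t - g t)// subr_eq0 => /eqP.
- change {ae mu, forall t, (f - g) t = 0}.
  apply: (@filterS _ _ aeF _ _ _ fg) => t fgt.
  by rewrite [LHS](_ : _ = f t - g t)// fgt subrr.
Qed.

Lemma L1_eqP (f g : L1) : f = g <-> {ae mu, forall t, f t = g t}.
Proof. by rewrite -pi_L1_eq !reprK. Qed.

Lemma L1_piE (f : intfun) : {ae mu, forall t, (\pi_L1 f : L1) t = f t}.
Proof. by apply/pi_L1_eq; rewrite reprK. Qed.

Lemma L1_classE f (fi : cintegrable mu f) :
  {ae mu, forall t, L1_class fi t = f t}.
Proof. exact: L1_piE. Qed.

Lemma L1_0E : {ae mu, forall t, (0 : L1) t = 0}.
Proof.
have -> : (0 : L1) = \pi_L1 0 by rewrite piE.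
exact: L1_piE.
Qed.

Lemma L1_DE (f g : L1) : {ae mu, forall t, (f + g : L1) t = f t + g t}.
Proof.
have -> : f + g = \pi_L1 (repr f + repr g) by rewrite raddfD /= !reprK.
exact: L1_piE.
Qed.

Definition L1_scale (k : R[i]) (f : L1) : L1 := \pi_L1 (k *: repr f).

Lemma L1_scaleE k f : {ae mu, forall t, L1_scale k f t = k * f t}.
Proof. exact: L1_piE. Qed.

Fact L1_scaleA a b f : L1_scale a (L1_scale b f) = L1_scale (a * b) f.
Proof.
apply/L1_eqP; apply: (@filterS3 _ _ aeF _ _ _ _ _ (L1_scaleE a (L1_scale b f))
  (L1_scaleE b f) (L1_scaleE (a * b) f)) => t -> -> ->.
by rewrite mulrA.
Qed.

Fact L1_scale1 : left_id 1 L1_scale.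
Proof.
move=> f; apply/L1_eqP; apply: (@filterS _ _ aeF _ _ _ (L1_scaleE 1 f)) => t ->.
by rewrite mul1r.
Qed.

Fact L1_scaleDr : right_distributive L1_scale +%R.
Proof.
move=> k f g; apply/L1_eqP.
have h := @filterS2 _ _ aeF _ _ _ (fun _ => pair) (L1_scaleE k f) (L1_scaleE k g).
have h' := @filterS2 _ _ aeF _ _ _ (fun _ => pair) (L1_scaleE k (f + g)) (L1_DE f g).
apply: (@filterS3 _ _ aeF _ _ _ _ _ (L1_DE (L1_scale k f) (L1_scale k g)) h h').
by move=> t -> [-> ->] [-> ->]; rewrite mulrDr.
Qed.

Fact L1_scaleDl f : {morph L1_scale^~ f : a b / a + b}.
Proof.
move=> a b; apply/L1_eqP.
have h := @filterS2 _ _ aeF _ _ _ (fun _ => pair) (L1_scaleE a f) (L1_scaleE b f).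
apply: (@filterS3 _ _ aeF _ _ _ _ _ (L1_DE (L1_scale a f) (L1_scale b f)) h
  (L1_scaleE (a + b) f)).
by move=> t -> [-> ->] ->; rewrite mulrDl.
Qed.

HB.instance Definition _ := GRing.Zmodule_isLmodule.Build R[i] L1
  L1_scaleA L1_scale1 L1_scaleDr L1_scaleDl.

Lemma L1_ZE (k : R[i]) (f : L1) : {ae mu, forall t, (k *: f : L1) t = k * f t}.
Proof. exact: L1_scaleE. Qed.

Definition L1_norm (f : L1) : R[i] := (\int[mu]_t modulus (f t))%:C.

Let norm_integrable (f : L1) : mu.-integrable setT (fun t => (modulus (f t))%:E).
Proof. exact/modulus_integrable/L1_integrable. Qed.

Lemma ae_eq_Rintegral_modulus (f g : R -> R[i]) :
  cmeasurable f -> cmeasurable g -> {ae mu, forall t, f t = g t} ->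
  \int[mu]_t modulus (f t) = \int[mu]_t modulus (g t).
Proof.
move=> mf mg fg; rewrite /Rintegral; congr fine.
apply: ae_eq_integral => //; try exact/measurable_EFinP/cmeasurable_modulus.
by apply: (@filterS _ _ aeF _ _ _ fg) => t /= -> _.
Qed.

Fact L1_ler_normD f g : L1_norm (f + g) <= L1_norm f + L1_norm g.
Proof.
rewrite /L1_norm -rmorphD lecR -RintegralD//; [|exact: norm_integrable..].
rewrite (ae_eq_Rintegral_modulus _ _ (L1_DE f g)); last 2 first.
- exact: L1_measurable.
- by apply: cmeasurableD; exact: L1_measurable.
apply: le_Rintegral => //.
- apply: modulus_integrable; apply: cintegrableD; exact: L1_integrable.
- exact: (integrableD measurableT (norm_integrable f) (norm_integrable g)).
- by move=> t _; exact: modulusD.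
Qed.

Fact L1_normZ (k : R[i]) f : L1_norm (k *: f) = `|k| * L1_norm f.
Proof.
rewrite /L1_norm norm_modulus -rmorphM -RintegralZl//; last exact: norm_integrable.
rewrite (ae_eq_Rintegral_modulus _ _ (L1_ZE k f)); last 2 first.
- exact: L1_measurable.
- exact: cintegrable_measurable (cintegrableZ k (L1_integrable f)).
by under eq_Rintegral do rewrite modulusM.
Qed.

Fact L1_norm0_eq0 f : L1_norm f = 0 -> f = 0.
Proof.
move=> [f0]; apply/L1_eqP.
have mf : measurable_fun setT (fun t => (modulus (f t))%:E).
  exact/measurable_EFinP/cmeasurable_modulus/L1_measurable.
have [fae _] := ae_eq_integral_abs mu measurableT mf.
have : (\int[mu]_t `|(modulus (f t))%:E|)%E = 0.
  have /integrableP[_ fi] := norm_integrable f.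
  have e : (\int[mu]_t `|(modulus (f t))%:E| = \int[mu]_t (modulus (f t))%:E)%E.
    by apply: eq_integral => t _; rewrite abse_EFin ger0_norm ?modulus_ge0.
  rewrite e in fi *; rewrite -[LHS]fineK ?[fine _]f0//.
  rewrite ge0_fin_numE//; apply: integral_ge0 => t _.
  by rewrite lee_fin modulus_ge0.
move=> /fae f0ae.
apply: (@filterS2 _ _ aeF _ _ _ _ f0ae L1_0E) => t /(_ I) [/modulus_eq0 -> ->].
by [].
Qed.

HB.instance Definition _ := Lmodule_isNormed.Build R[i] L1
  L1_ler_normD L1_normZ L1_norm0_eq0.

Lemma L1_normE (f : L1) : `|f| = (\int[mu]_t modulus (f t))%:C.
Proof. by []. Qed.

End L1_def.

Section complex_fubini.
Context d1 d2 (T1 : measurableType d1) (T2 : measurableType d2) (R : realType).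
Variable m1 : {sigma_finite_measure set T1 -> \bar R}.
Variable m2 : {sigma_finite_measure set T2 -> \bar R}.

Lemma Rintegrable_fubini (h : T1 * T2 -> R) :
  (m1 \x m2)%E.-integrable setT (fun z => (h z)%:E) ->
  m1.-integrable setT (fun x => (\int[m2]_y h (x, y))%:E).
Proof.
move=> hi; have hF := integrable_fubini_F hi.
apply: (le_integrable measurableT _ _ hF).
- apply/measurable_EFinP; apply: (measurableT_comp (@fine_measurable R _ measurableT)).
  exact: measurable_int hF.
- have hfine (z : \bar R) : (`|(fine z)%:E| <= `|z|)%E.
    by case: z => [r| |] //=; rewrite normr0 leey.
  by move=> x _; exact: hfine.
Qed.

Lemma Rintegral_fubini (h : T1 * T2 -> R) :
  (m1 \x m2)%E.-integrable setT (fun z => (h z)%:E) ->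
  \int[m1]_x \int[m2]_y h (x, y) = \int[m2]_y \int[m1]_x h (x, y).
Proof.
move=> hi; rewrite /Rintegral; congr fine.
transitivity (\int[m1]_x \int[m2]_y (h (x, y))%:E)%E.
  have mF := measurable_fubini_F hi.
  apply: ae_eq_integral => //.
    by apply/measurable_EFinP/(measurableT_comp (@fine_measurable R _ measurableT)).
  apply: filterS (ae_integrable1 hi) => x hx _.
  by rewrite fineK//; exact: integrable_fin_num.
rewrite (Fubini hi).
have mG := measurable_fubini_G hi.
apply: ae_eq_integral => //.
  by apply/measurable_EFinP/(measurableT_comp (@fine_measurable R _ measurableT)).
apply: filterS (ae_integrable2 hi) => x hx _.
by rewrite fineK//; exact: integrable_fin_num.
Qed.

Variable F : T1 * T2 -> R[i].

Lemma cintegrable_prod : cmeasurable F ->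
  (\int[m2]_y \int[m1]_x (modulus (F (x, y)))%:E < +oo)%E ->
  cintegrable (m1 \x m2)%E F.
Proof.
move=> mF Foo; apply/cintegrableP; split => //.
have mm : measurable_fun setT (fun z => (modulus (F z))%:E).
  exact/measurable_EFinP/cmeasurable_modulus.
apply/(integrable21ltyP m1 m2 mm).
rewrite (le_lt_trans _ Foo)// le_eqVlt; apply/orP; left; apply/eqP.
apply: eq_integral => y _; apply: eq_integral => x _.
by rewrite abse_EFin ger0_norm ?modulus_ge0.
Qed.

Hypothesis Fi : cintegrable (m1 \x m2)%E F.

Lemma cintegrable_fubini :
  cintegrable m1 (fun x => cintegral m2 (fun y => F (x, y))).
Proof.
case: Fi => Fr Fim; split.
- exact: (Rintegrable_fubini Fr).
- exact: (Rintegrable_fubini Fim).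
Qed.

Lemma cmeasurable_fubini2 :
  cmeasurable (fun y => cintegral m1 (fun x => F (x, y))).
Proof.
case: Fi => /measurable_fubini_G Fr /measurable_fubini_G Fim; split.
- exact: (measurableT_comp (@fine_measurable R _ measurableT) Fr).
- exact: (measurableT_comp (@fine_measurable R _ measurableT) Fim).
Qed.

Lemma ae_cintegrable1 : {ae m1, forall x, cintegrable m2 (fun y => F (x, y))}.
Proof.
by case: Fi => /ae_integrable1 Fr /ae_integrable1 Fim; apply: filterS2 Fr Fim.
Qed.

Lemma ae_cintegrable2 : {ae m2, forall y, cintegrable m1 (fun x => F (x, y))}.
Proof.
by case: Fi => /ae_integrable2 Fr /ae_integrable2 Fim; apply: filterS2 Fr Fim.
Qed.

Lemma cFubini :
  cintegral m1 (fun x => cintegral m2 (fun y => F (x, y))) =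
  cintegral m2 (fun y => cintegral m1 (fun x => F (x, y))).
Proof.
case: Fi => Fr Fim; rewrite /cintegral /=.
by rewrite (Rintegral_fubini Fr) (Rintegral_fubini Fim).
Qed.

End complex_fubini.

Section measure_preserving.
Context (R : realType).
Local Notation mu := (@lebesgue_measure R).
Local Notation TR := (measurableTypeR R).
Let aeF := ae_filter_ringOfSetsType mu.

Definition preserves (phi : TR -> TR) :=
  measurable_fun setT phi /\
  forall A, measurable A -> mu (phi @^-1` A) = mu A.

Lemma preserves_shift (a : R) : preserves (fun t => t + a).
Proof.
have mphi : measurable_fun setT (fun t : TR => (t + a : TR)).
  by apply: measurable_funD.
split => // A mA; apply/esym.
apply: (@lebesgue_measure_unique _ (pushforward mu (fun t : TR => t + a : TR))) => //.
move=> _ [[b c]] _ <-; rewrite /pushforward.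
rewrite /= [X in _ = lebesgue_measure X](_ : _ = `]b - a, c - a]%classic); last first.
  by apply/seteqP; split=> t /=; rewrite !in_itv/= ltrBlDr lerBrDr.
rewrite !lebesgue_measure_itv/= !lte_fin; congr (if _ then _ else _).
  by apply/idP/idP => ?; lra.
by rewrite -!EFinB; congr (_%:E); ring.
Qed.

Lemma preserves_reflect (s : R) : preserves (fun t => s - t).
Proof.
have mphi : measurable_fun setT (fun t : TR => (s - t : TR)).
  by apply: measurable_funB.
split => // A mA; apply/esym.
apply: (@lebesgue_measure_unique _ (pushforward mu (fun t : TR => s - t : TR))) => //.
move=> _ [[b c]] _ <-; rewrite /pushforward.
rewrite /= [X in _ = lebesgue_measure X](_ : _ = `[s - c, s - b[%classic); last first.
  apply/seteqP; split=> t /=; rewrite !in_itv/= => /andP[h1 h2]; apply/andP; split; lra.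
rewrite !lebesgue_measure_itv/= !lte_fin; congr (if _ then _ else _).
  by apply/idP/idP => ?; lra.
by rewrite -!EFinB; congr (_%:E); ring.
Qed.

Variable phi : TR -> TR.
Hypothesis pphi : preserves phi.

Lemma ae_preserves (P : R -> Prop) :
  {ae mu, forall t, P t} -> {ae mu, forall t, P (phi t)}.
Proof.
case: pphi => mphi ephi [A [mA A0 PA]].
exists (phi @^-1` A); split.
- by rewrite -[X in measurable X]setTI; exact: mphi.
- by rewrite ephi.
- by move=> t /= Pt; exact: PA.
Qed.

Lemma ge0_integral_preserves (h : R -> \bar R) :
  measurable_fun (setT : set TR) h -> (forall t, 0 <= h t)%E ->
  (\int[mu]_t h (phi t) = \int[mu]_t h t)%E.
Proof.
case: pphi => mphi ephi mh h0.
have := @ge0_integral_pushforward _ _ TR TR R phi mphi mu setT h measurableT mh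
  (fun t _ => h0 t).
rewrite preimage_setT /= => <-.
by apply: eq_measure_integral => A mA _; first [exact: ephi | exact/esym/ephi].
Qed.

Lemma Rintegral_preserves (h : R -> R) : measurable_fun (setT : set TR) h ->
  \int[mu]_t h (phi t) = \int[mu]_t h t.
Proof.
move=> mh; rewrite /Rintegral; congr fine.
have mh' : measurable_fun (setT : set TR) (fun t => (h t)%:E) by exact/measurable_EFinP.
rewrite integralE [RHS]integralE; congr (_ - _)%E.
- rewrite -(ge0_integral_preserves (measurable_funepos mh') (fun t => funepos_ge0 _ t)).
  by apply: eq_integral => t _; rewrite !funeposE.
- rewrite -(ge0_integral_preserves (measurable_funeneg mh') (fun t => funeneg_ge0 _ t)).
  by apply: eq_integral => t _; rewrite !funenegE.
Qed.

Lemma cmeasurable_preserves (f : TR -> R[i]) : cmeasurable f ->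
  cmeasurable (fun t => f (phi t)).
Proof.
case: pphi => mphi _ [fr fi]; split.
- exact: (measurableT_comp fr mphi).
- exact: (measurableT_comp fi mphi).
Qed.

Lemma cintegral_preserves (f : TR -> R[i]) : cmeasurable f ->
  cintegral mu (fun t => f (phi t)) = cintegral mu f.
Proof.
move=> [fr fi]; rewrite /cintegral; congr (_ +i* _).
- exact: (Rintegral_preserves fr).
- exact: (Rintegral_preserves fi).
Qed.

End measure_preserving.

Section convolution.
Context (R : realType).
Local Notation mu := (@lebesgue_measure R).
Local Notation TR := (measurableTypeR R).
Let aeF := ae_filter_ringOfSetsType mu.
Implicit Types f g h : R -> R[i].

Definition convolution f g : R -> R[i] :=
  fun s => cintegral mu (fun t => f (s - t) * g t).

Definition mass f : \bar R := (\int[mu]_t (modulus (f t))%:E)%E.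

Lemma measurable_emodulus d (T : measurableType d) (f : T -> R[i]) :
  cmeasurable f -> measurable_fun setT (fun t => (modulus (f t))%:E).
Proof. by move=> mf; exact/measurable_EFinP/cmeasurable_modulus. Qed.

Lemma cmeasurable_comp d d' (T : measurableType d) (T' : measurableType d')
    (phi : T -> T') (f : T' -> R[i]) :
  measurable_fun setT phi -> cmeasurable f -> cmeasurable (fun x => f (phi x)).
Proof.
move=> mphi [fr fi]; split.
- exact: (measurableT_comp fr mphi).
- exact: (measurableT_comp fi mphi).
Qed.

Lemma cmeasurable_fst (f : TR -> R[i]) : cmeasurable f ->
  cmeasurable (fun p : TR * TR => f p.1).
Proof. exact: (cmeasurable_comp measurable_fst). Qed.

Lemma cmeasurable_snd (f : TR -> R[i]) : cmeasurable f ->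
  cmeasurable (fun p : TR * TR => f p.2).
Proof. exact: (cmeasurable_comp measurable_snd). Qed.

Lemma cmeasurable_sub (f : TR -> R[i]) : cmeasurable f ->
  cmeasurable (fun p : TR * TR => f (p.1 - p.2)).
Proof.
move=> mf; apply: (@cmeasurable_comp _ _ _ TR (fun p : TR * TR => p.1 - p.2 : TR)) => //.
exact: measurable_funB.
Qed.

Lemma massE f : cintegrable mu f ->
  mass f = (\int[mu]_t modulus (f t))%:E.
Proof.
move=> /modulus_integrable fi; rewrite /Rintegral fineK//.
exact: integrable_fin_num.
Qed.

Lemma mass_lty f : cintegrable mu f -> (mass f < +oo)%E.
Proof. by move=> fi; rewrite massE// ltry. Qed.

Lemma mass_ge0 f : (0 <= mass f)%E.
Proof. by apply: integral_ge0 => t _; rewrite lee_fin modulus_ge0. Qed.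

Lemma cintegrable_mass f : cmeasurable (f : TR -> R[i]) -> (mass f < +oo)%E ->
  cintegrable mu f.
Proof.
move=> mf foo; apply/cintegrableP; split => //; apply/integrableP; split.
  exact: measurable_emodulus.
rewrite (le_lt_trans _ foo)// le_eqVlt; apply/orP; left; apply/eqP.
by apply: eq_integral => t _; rewrite abse_EFin ger0_norm ?modulus_ge0.
Qed.

Lemma le_modulus_cintegral_mass f : cmeasurable (f : TR -> R[i]) ->
  ((modulus (cintegral mu f))%:E <= mass f)%E.
Proof.
move=> mf; have [foo|] := boolP (mass f < +oo)%E; last first.
  by rewrite -leNgt leye_eq => /eqP ->; rewrite leey.
have fi := cintegrable_mass mf foo.
by rewrite massE// lee_fin; exact: le_modulus_cintegral.
Qed.

Lemma cmeasurable_kernel f g :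
  cmeasurable (f : TR -> R[i]) -> cmeasurable (g : TR -> R[i]) ->
  cmeasurable (fun p : TR * TR => f (p.1 - p.2) * g p.2).
Proof.
move=> mf mg; apply: cmeasurableM; first exact: cmeasurable_sub.
exact: cmeasurable_snd.
Qed.

Lemma integral_kernel f g :
  cmeasurable (f : TR -> R[i]) -> cintegrable mu g ->
  (\int[mu]_t \int[mu]_s (modulus (f (s - t) * g t))%:E = mass f * mass g)%E.
Proof.
move=> mf ig; have mg := cintegrable_measurable ig.
transitivity (\int[mu]_t (mass f * (modulus (g t))%:E))%E.
  apply: eq_integral => t _.
  under eq_integral do rewrite modulusM EFinM.
  rewrite ge0_integralZr//; first last.
  - by rewrite lee_fin modulus_ge0.
  - by move=> s _; rewrite lee_fin modulus_ge0.
  - apply: measurable_emodulus.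
    exact: (cmeasurable_preserves (preserves_shift (- t)) mf).
  congr (_ * _)%E.
  apply: (ge0_integral_preserves (preserves_shift (- t)) (measurable_emodulus mf)).
  by move=> s; rewrite lee_fin modulus_ge0.
rewrite ge0_integralZl//.
- exact: measurable_emodulus.
- by move=> s _; rewrite lee_fin modulus_ge0.
- exact: mass_ge0.
Qed.

Lemma cintegrable_kernel f g : cintegrable mu f -> cintegrable mu g ->
  cintegrable (mu \x mu)%E (fun p : TR * TR => f (p.1 - p.2) * g p.2).
Proof.
move=> fi gi; have mf := cintegrable_measurable fi.
apply: cintegrable_prod.
  by apply: cmeasurable_kernel => //; exact: cintegrable_measurable gi.
rewrite (integral_kernel mf gi) lte_mul_pinfty ?mass_ge0 ?mass_lty//.
by rewrite ge0_fin_numE ?mass_ge0 ?mass_lty.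
Qed.

Lemma convolution_integrable f g : cintegrable mu f -> cintegrable mu g ->
  cintegrable mu (convolution f g).
Proof. by move=> fi gi; exact: cintegrable_fubini (cintegrable_kernel fi gi). Qed.

Lemma ae_convolution_integrable f g : cintegrable mu f -> cintegrable mu g ->
  {ae mu, forall s, cintegrable mu (fun t => f (s - t) * g t)}.
Proof. by move=> fi gi; exact: ae_cintegrable1 (cintegrable_kernel fi gi). Qed.

Lemma mass_convolution f g : cintegrable mu f -> cintegrable mu g ->
  (mass (convolution f g) <= mass f * mass g)%E.
Proof.
move=> fi gi; have mf := cintegrable_measurable fi.
have mg := cintegrable_measurable gi.
have mk := cmeasurable_kernel mf mg.
rewrite -(integral_kernel mf gi).
rewrite -(@fubini_tonelli _ _ _ _ _ mu mu
  (fun p : TR * TR => (modulus (f (p.1 - p.2) * g p.2))%:E)); last 2 first.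
- exact: (measurable_emodulus mk).
- by move=> p; rewrite lee_fin modulus_ge0.
apply: ge0_le_integral => //.
- by move=> s _; rewrite lee_fin modulus_ge0.
- exact/measurable_emodulus/cintegrable_measurable/convolution_integrable.
- apply: (@measurable_fun_fubini_tonelli_F _ _ _ _ _ mu
    (fun p : TR * TR => (modulus (f (p.1 - p.2) * g p.2))%:E)) => //.
  + exact: (measurable_emodulus mk).
  + by move=> p; rewrite lee_fin modulus_ge0.
move=> s _; apply: le_modulus_cintegral_mass; apply: cmeasurableM => //.
exact: (cmeasurable_preserves (preserves_reflect s) mf).
Qed.

Lemma cmeasurable_reflectM f g (s : R) :
  cmeasurable (f : TR -> R[i]) -> cmeasurable (g : TR -> R[i]) ->
  cmeasurable (fun t : TR => f (s - t) * g t).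
Proof.
move=> mf mg; apply: cmeasurableM => //.
exact: (cmeasurable_preserves (preserves_reflect s) mf).
Qed.

Lemma ae_eq_convolution f f' g g' :
  cmeasurable (f : TR -> R[i]) -> cmeasurable (f' : TR -> R[i]) ->
  cmeasurable (g : TR -> R[i]) -> cmeasurable (g' : TR -> R[i]) ->
  {ae mu, forall t, f t = f' t} -> {ae mu, forall t, g t = g' t} ->
  convolution f g = convolution f' g'.
Proof.
move=> mf mf' mg mg' ff' gg'; apply/funext => s.
apply: ae_eq_cintegral; try exact: cmeasurable_reflectM.
apply: (@filterS2 _ _ aeF _ _ _ _ (ae_preserves (preserves_reflect s) ff') gg').
by move=> t -> ->.
Qed.

Lemma convolutionA f g h :
  cintegrable mu f -> cintegrable mu g -> cintegrable mu h ->
  {ae mu, forall s, convolution f (convolution g h) s =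
                    convolution (convolution f g) h s}.
Proof.
move=> fi gi hi.
have mf := cintegrable_measurable fi.
have mg := cintegrable_measurable gi.
have mh := cintegrable_measurable hi.
pose abs (k : R -> R[i]) : R -> R[i] := fun t => (modulus (k t))%:C.
have modabs (k : R -> R[i]) t : modulus (abs k t) = modulus (k t).
  by rewrite /abs modulusE /= expr0n addr0 sqrtr_sqr ger0_norm ?modulus_ge0.
have absi (k : R -> R[i]) : cintegrable mu k -> cintegrable mu (abs k).
  move=> ki; apply: cintegrable_mass.
    split; last exact: measurable_cst.
    exact: (cmeasurable_modulus (cintegrable_measurable ki)).
  by rewrite /mass; under eq_integral do rewrite modabs; exact: mass_lty.
have abs_conv := convolution_integrable (absi _ gi) (absi _ hi).
have aeK := ae_convolution_integrable (absi _ fi) abs_conv.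
have ae_gh := ae_convolution_integrable gi hi.
have ae_fg := ae_convolution_integrable fi gi.
apply: (@filterS _ _ aeF _ _ _ aeK) => s Ks.
have mfs : cmeasurable (fun v : TR => f (s - v)).
  exact: (cmeasurable_preserves (preserves_reflect s) mf).
pose K (p : TR * TR) : R[i] := f (s - p.2) * (g (p.2 - p.1) * h p.1).
have mK : cmeasurable K.
  apply: cmeasurableM.
    exact: (cmeasurable_snd mfs).
  apply: cmeasurableM; last exact: cmeasurable_fst.
  apply: (@cmeasurable_comp _ _ _ TR (fun p : TR * TR => p.2 - p.1 : TR)) => //.
  exact: measurable_funB.
have iK : cintegrable (mu \x mu)%E K.
  apply: cintegrable_prod => //.
  rewrite (le_lt_trans _ (mass_lty Ks))// le_eqVlt; apply/orP; left; apply/eqP.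
  apply: ae_eq_integral => //.
  - apply: (@measurable_fun_fubini_tonelli_G _ _ _ _ _ mu
      (fun p : TR * TR => (modulus (K p))%:E)).
    + exact: measurable_emodulus.
    + by move=> p; rewrite lee_fin modulus_ge0.
  - exact: (measurable_emodulus (cintegrable_measurable Ks)).
  apply: (@filterS _ _ aeF _ _ _ ae_gh) => v ghv _.
  transitivity (\int[mu]_t ((modulus (f (s - v)))%:E * (modulus (g (v - t) * h t))%:E))%E.
    by apply: eq_integral => t _; rewrite /K /= -EFinM -modulusM.
  rewrite ge0_integralZl//; first last.
  - by rewrite lee_fin modulus_ge0.
  - by move=> t _; rewrite lee_fin modulus_ge0.
  - exact: (measurable_emodulus (cintegrable_measurable ghv)).
  rewrite modulusM modabs EFinM; congr (_ * _)%E.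
  rewrite -/(mass _) massE//; congr (_%:E).
  have -> : convolution (abs g) (abs h) v =
      (\int[mu]_t modulus (g (v - t) * h t))%:C.
    rewrite /convolution (_ : (fun t => _) =
        (fun t => (modulus (g (v - t) * h t))%:C)); last first.
      by apply/funext => t; rewrite modulusM rmorphM.
    by rewrite /cintegral /= Rintegral_cst// mul0r.
  rewrite modulusE /= expr0n addr0 sqrtr_sqr ger0_norm//.
  by apply: Rintegral_ge0 => t _; exact: modulus_ge0.
transitivity (cintegral mu (fun v => cintegral mu (fun t => K (t, v)))).
  apply: ae_eq_cintegral.
  - by apply: cmeasurableM => //; exact: (cintegrable_measurable (convolution_integrable gi hi)).
  - exact: (cmeasurable_fubini2 iK).
  apply: (@filterS _ _ aeF _ _ _ ae_gh) => v ghv.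
  by rewrite /K /= cintegralZ.
rewrite -(cFubini iK).
apply: ae_eq_cintegral.
- exact: (cintegrable_measurable (cintegrable_fubini iK)).
- apply: cmeasurable_reflectM => //.
  exact: (cintegrable_measurable (convolution_integrable fi gi)).
apply: (@filterS _ _ aeF _ _ _ (ae_preserves (preserves_reflect s) ae_fg)) => t fgt.
have mKt : cmeasurable (fun v : TR => K (t, v)).
  apply: (@cmeasurable_comp _ _ _ _ (fun v : TR => (t, v))) => //.
  exact: pair1_measurable.
rewrite -(cintegral_preserves (preserves_shift t) mKt) mulrC -cintegralZ//.
apply: eq_cintegral => u; rewrite /K /= addrK opprD addrA (addrAC s).
by rewrite [s - t - u]addrAC mulrA mulrC.
Qed.

Lemma convolutionDl f f' g :
  cintegrable mu f -> cintegrable mu f' -> cintegrable mu g ->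
  {ae mu, forall s, convolution (fun t => f t + f' t) g s =
                    convolution f g s + convolution f' g s}.
Proof.
move=> fi fi' gi.
apply: (@filterS2 _ _ aeF _ _ _ _ (ae_convolution_integrable fi gi)
  (ae_convolution_integrable fi' gi)) => s k k'.
by rewrite -cintegralD//; apply: eq_cintegral => t; rewrite mulrDl.
Qed.

Lemma convolutionDr f g g' :
  cintegrable mu f -> cintegrable mu g -> cintegrable mu g' ->
  {ae mu, forall s, convolution f (fun t => g t + g' t) s =
                    convolution f g s + convolution f g' s}.
Proof.
move=> fi gi gi'.
apply: (@filterS2 _ _ aeF _ _ _ _ (ae_convolution_integrable fi gi)
  (ae_convolution_integrable fi gi')) => s k k'.
by rewrite -cintegralD//; apply: eq_cintegral => t; rewrite mulrDr.
Qed.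

Lemma convolutionZl k f g : cintegrable mu f -> cintegrable mu g ->
  {ae mu, forall s, convolution (fun t => k * f t) g s = k * convolution f g s}.
Proof.
move=> fi gi.
apply: (@filterS _ _ aeF _ _ _ (ae_convolution_integrable fi gi)) => s i.
by rewrite -cintegralZ//; apply: eq_cintegral => t; rewrite mulrA.
Qed.

Lemma convolutionZr k f g : cintegrable mu f -> cintegrable mu g ->
  {ae mu, forall s, convolution f (fun t => k * g t) s = k * convolution f g s}.
Proof.
move=> fi gi.
apply: (@filterS _ _ aeF _ _ _ (ae_convolution_integrable fi gi)) => s i.
by rewrite -cintegralZ//; apply: eq_cintegral => t; rewrite mulrCA.
Qed.

End convolution.

Section L1_algebra.
Context (R : realType).
Local Notation mu := (@lebesgue_measure R).
Local Notation L1 := (L1 R).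
Let aeF := ae_filter_ringOfSetsType mu.
Implicit Types f g h : L1.

Definition L1_mul f g : L1 :=
  L1_class (convolution_integrable (L1_integrable f) (L1_integrable g)).

Lemma L1_mulE f g : {ae mu, forall s, L1_mul f g s = convolution f g s}.
Proof. exact: L1_classE. Qed.

Let ae_convolution f g (f' g' : R -> R[i]) :
  cintegrable mu f' -> cintegrable mu g' ->
  {ae mu, forall t, f t = f' t} -> {ae mu, forall t, g t = g' t} ->
  {ae mu, forall s, L1_mul f g s = convolution f' g' s}.
Proof.
move=> fi gi ff gg.
have mf := cintegrable_measurable fi; have mg := cintegrable_measurable gi.
have mF := L1_measurable f; have mG := L1_measurable g.
by rewrite -(ae_eq_convolution mF mf mG mg ff gg); exact: L1_mulE.
Qed.

Let aeE (f : L1) : {ae mu, forall t, f t = f t}. Proof. exact: aeW. Qed.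

Fact L1_mulA : associative L1_mul.
Proof.
move=> f g h; apply/L1_eqP.
have fi := L1_integrable f; have gi := L1_integrable g; have hi := L1_integrable h.
have l := ae_convolution fi (convolution_integrable gi hi) (aeE f) (L1_mulE g h).
have r := ae_convolution (convolution_integrable fi gi) hi (L1_mulE f g) (aeE h).
by apply: (@filterS3 _ _ aeF _ _ _ _ _ l r (convolutionA fi gi hi)) => s -> -> ->.
Qed.

Fact L1_mulDl : left_distributive L1_mul +%R.
Proof.
move=> f f' g; apply/L1_eqP.
have fi := L1_integrable f; have fi' := L1_integrable f'; have gi := L1_integrable g.
have l := ae_convolution (cintegrableD fi fi') gi (L1_DE f f') (aeE g).
have r := @filterS2 _ _ aeF _ _ _ (fun _ => pair) (L1_mulE f g) (L1_mulE f' g).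
have lr := @filterS2 _ _ aeF _ _ _ (fun _ => pair) l (convolutionDl fi fi' gi).
apply: (@filterS3 _ _ aeF _ _ _ _ _ lr r (L1_DE (L1_mul f g) (L1_mul f' g))).
by move=> s [-> ->] [<- <-] ->.
Qed.

Fact L1_mulDr : right_distributive L1_mul +%R.
Proof.
move=> f g g'; apply/L1_eqP.
have fi := L1_integrable f; have gi := L1_integrable g; have gi' := L1_integrable g'.
have l := ae_convolution fi (cintegrableD gi gi') (aeE f) (L1_DE g g').
have r := @filterS2 _ _ aeF _ _ _ (fun _ => pair) (L1_mulE f g) (L1_mulE f g').
have lr := @filterS2 _ _ aeF _ _ _ (fun _ => pair) l (convolutionDr fi gi gi').
apply: (@filterS3 _ _ aeF _ _ _ _ _ lr r (L1_DE (L1_mul f g) (L1_mul f g'))).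
by move=> s [-> ->] [<- <-] ->.
Qed.

Fact L1_mulZl (k : R[i]) f g : L1_mul (k *: f) g = k *: L1_mul f g.
Proof.
apply/L1_eqP; have fi := L1_integrable f; have gi := L1_integrable g.
have l := ae_convolution (cintegrableZ k fi) gi (L1_ZE k f) (aeE g).
have r := @filterS2 _ _ aeF _ _ _ (fun _ => pair) (L1_mulE f g) (L1_ZE k (L1_mul f g)).
apply: (@filterS3 _ _ aeF _ _ _ _ _ l r (convolutionZl k fi gi)).
by move=> s -> [<- ->] ->.
Qed.

Fact L1_mulZr (k : R[i]) f g : L1_mul f (k *: g) = k *: L1_mul f g.
Proof.
apply/L1_eqP; have fi := L1_integrable f; have gi := L1_integrable g.
have l := ae_convolution fi (cintegrableZ k gi) (aeE f) (L1_ZE k g).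
have r := @filterS2 _ _ aeF _ _ _ (fun _ => pair) (L1_mulE f g) (L1_ZE k (L1_mul f g)).
apply: (@filterS3 _ _ aeF _ _ _ _ _ l r (convolutionZr k fi gi)).
by move=> s -> [<- ->] ->.
Qed.

Fact L1_ler_norm_mul f g : `|L1_mul f g| <= `|f| * `|g|.
Proof.
have fi := L1_integrable f; have gi := L1_integrable g.
have ci := convolution_integrable fi gi.
rewrite !L1_normE -rmorphM lecR.
rewrite (ae_eq_Rintegral_modulus _ _ (L1_mulE f g)); last 2 first.
- exact: L1_measurable.
- exact: cintegrable_measurable ci.
by rewrite -lee_fin EFinM -!massE//; exact: mass_convolution.
Qed.

HB.instance Definition _ := NormedModule_isNormedAlgebra.Build R[i] L1
  L1_mulA L1_mulDl L1_mulDr L1_mulZl L1_mulZr L1_ler_norm_mul.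

End L1_algebra.

(* The complement of the largest open set on which f vanishes almost everywhere. *)
Definition ess_support (R : realType) (f : R -> R[i]) : set R :=
  ~` \bigcup_(U in [set U : set R | open U /\
       {ae @lebesgue_measure R, forall t, U t -> f t = 0}]) U.

(* Main.v *)
Require Import Defs.
From HB Require Import structures.
From mathcomp Require Import all_boot all_order all_algebra.
From mathcomp Require Import complex.
From mathcomp Require Import lra.
From mathcomp Require Import all_classical all_reals all_analysis.
From mathcomp Require Import measurable_realfun.
Set Implicit Arguments.
Unset Strict Implicit.
Unset Printing Implicit Defensive.
Import Order.TTheory GRing.Theory Num.Theory.
Import numFieldNormedType.Exports.
Local Open Scope classical_set_scope.
Local Open Scope ring_scope.
Local Open Scope complex_scope.

(* Since f vanishes a.e. on some (-d, d), take for x the normalized indicator of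
   [0, d): then f * x vanishes on [0, d). Given |z| <= 1, the functional with
   density 1 on [0, d) and z elsewhere has norm 1, maps x to 1 and maps f * x to
   z times the integral of f * x, that is to ||f|| z because f >= 0. *)

Lemma modulus_real (R : rcfType) (r : R) : modulus r%:C = `|r|.
Proof. by rewrite modulusE /= expr0n addr0 sqrtr_sqr. Qed.

(** By homogeneity it is enough to bound the value at the normalized vector [|x|^-1 *: x], which is
    one of the values under the supremum. *)
Lemma dual_norm_bound (R : realType) (A : normedAlgType R[i])
    (phi : {linear A -> R[i]^o}) (x : A) :
  dual_norm phi = 1 -> `|phi x : R[i]| <= `|x|.
Proof.
rewrite /dual_norm; set E := (X in sup X) => E1.
(* [sup] takes the default value 0 on a set without a supremum, so the value 1 forces [E] to be
   bounded above. *)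
have [_ Eub] : has_sup E.
  apply: contrapT => /sup_out E0.
  by have := @oner_neq0 R; rewrite -E1 E0 eqxx.
have [->|x0] := eqVneq x 0; first by rewrite linear0 !normr0.
have nx0 : `|x| != 0 by rewrite normr_eq0.
have Ex : E (modulus (phi (`|x|^-1 *: x))).
  by exists (`|x|^-1 *: x) => //=; rewrite normrZ normfV normr_id mulVf.
have := ub_le_sup Eub Ex; rewrite E1.
rewrite linearZ /= modulusM -lecR rmorphM /= -!norm_modulus normfV normr_id.
by rewrite mulrC ler_pdivrMr ?mul1r// normr_gt0.
Qed.

Lemma spatial_range_sub (R : realType) (A : normedAlgType R[i]) (a : A) :
  spatial_range a `<=` [set `|a| * z | z in closed_unit_disc R].
Proof.
move=> w [x]; rewrite /unit_sphere/= => x1 [phi [_ phi1 _] <-].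
have bound : `|phi (amul a x) : R[i]| <= `|a|.
  apply: (le_trans (dual_norm_bound _ phi1)).
  by rewrite (le_trans (ler_norm_amul _ _))// x1 mulr1.
(* The point of the disc is found by dividing by [|a|]; when this norm is 0 the value itself is 0,
   and the centre serves. *)
have [a0|a0] := eqVneq `|a| 0.
  exists 0; first by rewrite /closed_unit_disc/= normr0.
  by move: bound; rewrite a0 normr_le0 mulr0 => /eqP ->.
exists (phi (amul a x) / `|a|); last by rewrite mulrC divfK.
rewrite /closed_unit_disc/= normrM normfV normr_id ler_pdivrMr ?mul1r//.
by rewrite lt_neqAle eq_sym a0 normr_ge0.
Qed.

(** Used to recognize support functionals: a contraction keeps the supremum at most 1, and the unit
    vector [x] attains it. *)
Lemma dual_norm_attained (R : realType) (A : normedAlgType R[i])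
    (phi : A -> R[i]^o) (x : A) :
  (forall y, `|phi y : R[i]| <= `|y|) -> `|x| = 1 -> phi x = 1 ->
  dual_norm phi = 1.
Proof.
move=> phib x1 phix; apply/le_anti/andP; split.
  apply: ge_sup; first by exists (modulus (phi x)), x; rewrite /= ?x1.
  by move=> _ [y /= y1 <-]; rewrite -lecR -norm_modulus (le_trans (phib y)).
apply: ub_le_sup; last first.
  by exists x; rewrite /= ?x1// phix modulus_real normr1.
by exists 1 => _ [y /= y1 <-]; rewrite -lecR -norm_modulus (le_trans (phib y)).
Qed.

(** Convex combinations have real coefficients, so the set is viewed in [Rcomplex R], the complex
    numbers as a real vector space. *)
Lemma convex_scaled_disc (R : realType) (a : R[i]) :
  convex_set ([set a * z | z in closed_unit_disc R]
    : set (convex_lmodType (Rcomplex R))).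
Proof.
move=> x y l; rewrite !inE => -[z z1 <-] [w w1 <-].
have scaleE (k : R) (u : Rcomplex R) : k *: u = k%:C * u :> R[i].
  by case: u => b c; apply/eqP; rewrite eq_complex /= !mul0r subr0 addr0 !eqxx.
have p0 : 0 <= l%:num by [].
have p1 : 0 <= 1 - l%:num by rewrite subr_ge0.
set p := l%:num in p0 p1.
exists (p%:C * z + (1 - p)%:C * w).
  rewrite /closed_unit_disc/= (le_trans (ler_normD _ _))// !normrM.
  rewrite !norm_modulus !modulus_real !ger0_norm// -!norm_modulus.
  (* With 1 split by the same weights, the triangle inequality is closed term by term. *)
  rewrite (_ : 1 = p%:C * 1 + (1 - p)%:C * 1 :> R[i]); last first.
    by rewrite !mulr1 -rmorphD addrC subrK.
  by rewrite lerD// ler_wpM2l// lecR.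
rewrite [RHS](_ : _ = p *: (a * z : Rcomplex R) + (1 - p) *: (a * w : Rcomplex R))//.
by rewrite !scaleE mulrDr; congr (_ + _); rewrite mulrCA.
Qed.

Section L1_functionals.
Context (R : realType).
Local Notation mu := (@lebesgue_measure R).
Let aeF := ae_filter_ringOfSetsType mu.

Lemma cintegrable_bounded (h g : R -> R[i]) :
  cmeasurable (h : measurableTypeR R -> R[i]) ->
  (forall t, modulus (h t) <= 1) ->
  cintegrable mu g -> cintegrable mu (fun t => h t * g t).
Proof.
move=> mh h1 gi; have mg := cintegrable_measurable gi.
apply/cintegrableP; split; first exact: cmeasurableM.
apply: le_integrable (modulus_integrable gi) => //.
  exact/measurable_EFinP/cmeasurable_modulus/cmeasurableM.
move=> t _; rewrite !abse_EFin lee_fin !ger0_norm ?modulus_ge0// modulusM.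
by rewrite ler_piMl ?modulus_ge0.
Qed.

(** Pairing with a density bounded by 1 is a contraction of [L1 R], and a bounded linear map is
    continuous. *)
Lemma weighted_functional (h : R -> R[i]) :
  cmeasurable (h : measurableTypeR R -> R[i]) ->
  (forall t, modulus (h t) <= 1) ->
  exists phi : {linear L1 R -> R[i]^o},
    [/\ continuous (phi : L1 R -> R[i]^o),
        (forall g, `|phi g : R[i]| <= `|g|) &
        forall g : L1 R, phi g = cintegral mu (fun t => h t * g t)].
Proof.
move=> mh h1; pose F (g : L1 R) : R[i]^o := cintegral mu (fun t => h t * g t).
have hgi (g : L1 R) := cintegrable_bounded mh h1 (L1_integrable g).
have Flin : linear F.
  move=> k; change (forall f g : L1 R, F (k *: f + g) = k *: F f + F g) => f g.
  rewrite /F.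
  transitivity (cintegral mu (fun t => k * (h t * f t) + h t * g t)).
    apply: ae_eq_cintegral; first exact: cintegrable_measurable (hgi _).
      exact/cintegrable_measurable/cintegrableD/hgi/cintegrableZ/hgi.
    apply: (@filterS2 _ _ aeF _ _ _ _ (L1_DE (k *: f) g) (L1_ZE k f)) => t -> ->.
    by rewrite mulrDr mulrCA.
  by rewrite cintegralD ?cintegralZ//; exact: cintegrableZ.
have Fbound g : `|F g : R[i]| <= `|g|.
  rewrite norm_modulus L1_normE lecR (le_trans (le_modulus_cintegral (hgi g)))//.
  apply: le_Rintegral => //; [exact: modulus_integrable..| |].
    exact/modulus_integrable/L1_integrable.
  by move=> t _; rewrite modulusM ler_piMl ?modulus_ge0.
pose phi : {linear L1 R -> R[i]^o} :=
  HB.pack F (GRing.isLinear.Build R[i] (L1 R) R[i]^o _ F Flin).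
exists phi; split => //.
apply/bounded_linear_continuous/bounded_funP => r; exists r => g gr.
exact: le_trans (Fbound g) gr.
Qed.

Lemma cintegrable_preserves (phi : measurableTypeR R -> measurableTypeR R)
    (f : R -> R[i]) : preserves phi -> cintegrable mu f ->
  cintegrable mu (fun t => f (phi t)).
Proof.
move=> pphi fi; have mf := cintegrable_measurable fi.
apply: cintegrable_mass; first exact: (cmeasurable_preserves pphi mf).
rewrite /mass (ge0_integral_preserves pphi (measurable_emodulus mf)).
  exact: mass_lty.
by move=> t; rewrite lee_fin modulus_ge0.
Qed.

(** After Fubini, the inner integral of [f (s - t)] over [s] is that of a translate of [f], hence
    independent of [t]. *)
Lemma cintegral_convolution (f g : R -> R[i]) :
  cintegrable mu f -> cintegrable mu g ->
  cintegral mu (convolution f g) = cintegral mu f * cintegral mu g.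
Proof.
move=> fi gi; have mf := cintegrable_measurable fi.
rewrite (cFubini (cintegrable_kernel fi gi)) -cintegralZ//.
apply: eq_cintegral => t /=.
rewrite -(cintegral_preserves (preserves_shift (- t)) mf) mulrC.
rewrite -cintegralZ; last exact: (cintegrable_preserves (preserves_shift (- t)) fi).
by apply: eq_cintegral => s; rewrite mulrC.
Qed.

(** In the order of [R[i]], [0 <= f t] makes [f t] real and nonnegative, hence equal to its
    modulus. *)
Lemma cintegral_ae_ge0 (f : L1 R) :
  {ae mu, forall t, 0 <= f t} -> cintegral mu f = `|f|.
Proof.
move=> f0; rewrite L1_normE /Rintegral.
transitivity (cintegral mu (fun t => (modulus (f t))%:C)).
  apply: ae_eq_cintegral; first exact: L1_measurable.
    split; last exact: measurable_cst.
    exact/cmeasurable_modulus/L1_measurable.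
  apply: (@filterS _ _ aeF _ _ _ f0) => t ft.
  by rewrite -norm_modulus ger0_norm.
by rewrite /cintegral /= Rintegral_cst// mul0r.
Qed.

(** A point outside the support lies in an open set on which [f] vanishes almost everywhere, and
    that set contains a ball around the point. *)
Lemma not_ess_supportP (f : R -> R[i]) (a : R) : ~ ess_support f a ->
  exists2 d : R, 0 < d & {ae mu, forall t, `|a - t| < d -> f t = 0}.
Proof.
move=> /contrapT[U [oU U0] Ua].
have /nbhs_ballP[d /= d0 dU] : nbhs a U by exact: open_nbhs_nbhs.
exists d => //; apply: (@filterS _ _ aeF _ _ _ U0) => t ft td.
exact/ft/dU.
Qed.

(** The uniform probability density on [[0, d)]; the interval is half-open so that two of its points
    differ by strictly less than [d]. *)
Definition mean_kernel (d : R) : R -> R[i] :=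
  fun t => (d^-1 * \1_`[0, d[%classic t)%:C.

Definition two_valued (d : R) (z : R[i]) : R -> R[i] :=
  fun t => if t \in `[0, d[ then 1 else z.

Lemma mean_kernel_integrable (d : R) : cintegrable mu (mean_kernel d).
Proof.
split; last exact: integrable0.
rewrite /mean_kernel /=; under eq_fun do rewrite EFinM.
by apply: integrableZl => //; exact: integrable_indic_itv.
Qed.

Lemma cintegral_mean_kernel (d : R) : 0 < d -> cintegral mu (mean_kernel d) = 1.
Proof.
move=> d0; rewrite /cintegral /mean_kernel/= Rintegral_cst// mul0r.
rewrite RintegralZl//; last exact: integrable_indic_itv.
have mud : mu `[0, d[%classic = d%:E.
  by rewrite lebesgue_measure_itv/= lte_fin d0 oppr0 adde0.
rewrite /Rintegral integral_indic// setIT [X in fine X]mud /= mulVf//.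
by rewrite gt_eqF.
Qed.

Lemma two_valued_measurable (d : R) z :
  cmeasurable (two_valued d z : measurableTypeR R -> R[i]).
Proof.
(* As an affine function of an indicator, the weight inherits measurability from the interval. *)
have -> : two_valued d z = fun t => z + (1 - z) * (\1_`[0, d[%classic t)%:C.
  apply/funext => t; rewrite /two_valued indicE mem_setE; case: ifP => _.
    by rewrite mulr1 addrC subrK.
  by rewrite mulr0 addr0.
apply: cmeasurableD; first by split; exact: measurable_cst.
apply: cmeasurableM; first by split; exact: measurable_cst.
by split; [exact: measurable_indic|exact: measurable_cst].
Qed.

Lemma two_valued_le1 d z t : `|z| <= 1 -> modulus (two_valued d z t) <= 1.
Proof.
rewrite norm_modulus lecR /two_valued; case: ifP => // _ _.
by rewrite modulus_real normr1.
Qed.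

(** The two weights differ only for [t] in [[0, d)]. There the convolution only sees [f (t - s)]
    with [s] in [[0, d)], that is, [f] at distance less than [d] from 0. *)
Lemma two_valued_convolution (f : R -> R[i]) (d : R) z t :
  cmeasurable (f : measurableTypeR R -> R[i]) ->
  {ae mu, forall t, `|0 - t| < d -> f t = 0} ->
  two_valued d z t * convolution f (mean_kernel d) t =
  z * convolution f (mean_kernel d) t.
Proof.
move=> mf f0; rewrite /two_valued; case: ifPn => // td.
suff -> : convolution f (mean_kernel d) t = 0 by rewrite !mulr0.
rewrite /convolution; transitivity (cintegral mu (fun=> 0 : R[i])).
  apply: ae_eq_cintegral.
  - apply: cmeasurable_reflectM => //.
    exact/cintegrable_measurable/mean_kernel_integrable.
  - by split; exact: measurable_cst.
  (* The reflection [s |-> t - s] preserves null sets, so [f (t - s) = 0] for almost every [s] with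
     [|t - s| < d]. *)
  apply: (@filterS _ _ aeF _ _ _ (ae_preserves (preserves_reflect t) f0)) => s fs.
  rewrite /mean_kernel indicE mem_setE; case: (boolP (s \in `[0, d[)) => sd.
    rewrite fs ?mul0r//; move: td sd; rewrite !in_itv/= => /andP[? ?] /andP[? ?].
    by rewrite ltr_norml; apply/andP; split; lra.
  by rewrite !mulr0.
by rewrite /cintegral /= Rintegral_cst// mul0r.
Qed.

End L1_functionals.

Theorem lemma2p10 (R : realType) (f : L1 R) :
  {ae @lebesgue_measure R, forall t, 0 <= f t} ->
  ~ ess_support f 0 ->
  spatial_range f = [set `|f| * z | z in closed_unit_disc R] /\
  convex_set (spatial_range f : set (convex_lmodType (Rcomplex R))).
Proof.
move=> f0 /not_ess_supportP[d d0 fd].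
suff E : spatial_range f = [set `|f| * z | z in closed_unit_disc R].
  by split=> //; rewrite E; exact: convex_scaled_disc.
apply/seteqP; split; first exact: spatial_range_sub.
move=> _ [z z1 <-].
have bi := mean_kernel_integrable d; have mb := cintegrable_measurable bi.
pose x : L1 R := L1_class bi.
have mh := two_valued_measurable d z.
have h1 t := two_valued_le1 d t z1.
have [phi [phic phib phiE]] := weighted_functional mh h1.
(* [x] is nonnegative almost everywhere, so its norm is its integral. *)
have x1 : `|x| = 1.
  rewrite -(cintegral_mean_kernel d0) -cintegral_ae_ge0; last first.
    apply: (@filterS _ _ (ae_filter_ringOfSetsType _) _ _ _ (L1_classE bi)) => t ->.
    by rewrite lecR mulr_ge0// ?indicE// invr_ge0 ltW.
  by apply: ae_eq_cintegral => //; [exact: L1_measurable|exact: L1_classE].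
have phix : phi x = 1.
  rewrite phiE -(cintegral_mean_kernel d0); apply: ae_eq_cintegral => //.
    by apply: cmeasurableM => //; exact: L1_measurable.
  apply: (@filterS _ _ (ae_filter_ringOfSetsType _) _ _ _ (L1_classE bi)) => t ->.
  (* On [[0, d)] the weight is 1; elsewhere the kernel is 0 and absorbs the weight [z]. *)
  rewrite /two_valued; case: ifPn => td; rewrite ?mul1r//.
  by rewrite /mean_kernel indicE mem_setE (negbTE td) mulr0 mulr0.
exists x => //; exists phi; first by split=> //; exact: dual_norm_attained phix.
have fi := L1_integrable f; have mf := L1_measurable f.
have ci := convolution_integrable fi bi.
(* The weight may be replaced by the constant [z], since the product of [f] and [x] vanishes where
   the weight is 1. *)
rewrite phiE; transitivity (cintegral lebesgue_measure
  (fun t => z * convolution f (mean_kernel d) t)).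
  apply: ae_eq_cintegral.
  - by apply: cmeasurableM => //; exact: L1_measurable.
  - by apply: (@cintegrable_measurable _ _ _ lebesgue_measure); exact: cintegrableZ.
  have fx : {ae lebesgue_measure,
      forall t, (amul f x : L1 R) t = convolution f x t}.
    exact: L1_mulE.
  apply: (@filterS _ _ (ae_filter_ringOfSetsType _) _ _ _ fx) => t ->.
  (* The representative of [x] agrees with the kernel only almost everywhere, but this gives the
     same convolution at every point. *)
  rewrite (ae_eq_convolution mf mf (L1_measurable x) mb
    (aeW _ (fun=> erefl)) (L1_classE bi)).
  exact: two_valued_convolution.
(* The integral factors as [z] times the integral of [f], which is [|f|] by nonnegativity, times the
   integral 1 of the kernel. *)
rewrite cintegralZ// cintegral_convolution// cintegral_mean_kernel// cintegral_ae_ge0//.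
by rewrite mulr1 mulrC.
Qed.
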